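(* Let $P$ be a monic prime in $A = \mathbb{F}_q[T]$ and let $\alpha \in \mathbb{F}_q^{\times}$, and set $M_P := \alpha C_P(1)$. Then $Q \equiv 1 \pmod{P}$ for every monic prime $Q$ of $A$ dividing $M_P$.
   Context: $q$ is a power of a prime, $A = \mathbb{F}_q[T]$. The Carlitz module is the unique $\mathbb{F}_q$-algebra homomorphism $a \mapsto C_a$ from $A$ to the ring of $\mathbb{F}_q$-linear polynomials in $A[x]$ (composition as multiplication) with $C_T(x) = Tx + x^q$; $C_a(1)$ is the value of $C_a(x)$ at $x=1$. *)

(* Defs.v *)
From HB Require Import structures.
From mathcomp Require Import all_boot all_order all_algebra.
From mathcomp Require Import pgroup abelian finfield.

Set Implicit Arguments.
Unset Strict Implicit.
Unset Printing Implicit Defensive.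

Import GRing.Theory.
Local Open Scope ring_scope.

(* Conventions: F is the field with q = #|F| elements, A = {poly F} with T
   its variable ('X : {poly F}), and A[x] = {poly {poly F}} with x its variable
   ('X : {poly {poly F}}).  The ring of F_q-linear polynomials has composition
   \Po as its product and 'X as its unit; c in F acts on it by c%:P *: _. *)

Definition Fq_linear (F : finFieldType) (f : {poly {poly F}}) : Prop :=
  forall i : nat, f`_i != 0 -> exists k : nat, i = (#|F| ^ k)%N.

Definition carlitzT (F : finFieldType) : {poly {poly F}} :=
  ('X : {poly F}) *: 'X + 'X^#|F|.

Record is_carlitz_module (F : finFieldType)
    (C : {poly F} -> {poly {poly F}}) : Prop := IsCarlitzModule {
  carlitz_module_Fq_linear : forall a, Fq_linear (C a);
  carlitz_moduleD : forall a b, C (a + b) = C a + C b;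
  carlitz_moduleZ : forall (c : F) a, C (c *: a) = c%:P *: C a;
  carlitz_module1 : C 1 = 'X;
  carlitz_moduleM : forall a b, C (a * b) = C a \Po C b;
  carlitz_moduleT : C 'X = carlitzT F
}.

(* C_(sum a_i T^i) = sum a_i C_(T^i), where C_(T^i) is the i-fold composite
   of C_T; [carlitzP] and [carlitz_unique] show that this is the Carlitz
   module. *)
Definition carlitz (F : finFieldType) (a : {poly F}) : {poly {poly F}} :=
  \sum_(i < size a) (a`_i)%:P *: iter i (fun f => carlitzT F \Po f) 'X.

Section CarlitzTheory.

Variable F : finFieldType.
Implicit Types (a b : {poly F}) (f g u v : {poly {poly F}}).

Let e i : {poly {poly F}} := iter i (fun f => carlitzT F \Po f) 'X.

Lemma carlitz_frobD u v : (u + v) ^+ #|F| = u ^+ #|F| + v ^+ #|F|.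
Proof.
have [p p_pr pF] := finPcharP F; apply: exprDn_pchar.
rewrite !(eq_pnat _ (pchar_poly _)) (eq_pnat _ (pcharf_eq pF)) -cardsT.
exact: (abelem_pgroup (fin_ring_pchar_abelem pF)).
Qed.

Lemma carlitzT_comp f : carlitzT F \Po f = 'X *: f + f ^+ #|F|.
Proof. by rewrite /carlitzT comp_polyD comp_polyZ comp_polyX comp_Xn_poly. Qed.

Lemma carlitzT_compD u v :
  carlitzT F \Po (u + v) = (carlitzT F \Po u) + (carlitzT F \Po v).
Proof. by rewrite !carlitzT_comp carlitz_frobD scalerDr addrACA. Qed.

Lemma carlitzT_compZ (c : F) u :
  carlitzT F \Po (c%:P *: u) = c%:P *: (carlitzT F \Po u).
Proof.
rewrite !carlitzT_comp exprZn -polyC_exp expf_card scalerDr.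
by rewrite !scalerA (mulrC 'X).
Qed.

Lemma carlitz_widen n a : (size a <= n)%N ->
  carlitz a = \sum_(i < n) (a`_i)%:P *: e i.
Proof.
move=> le_an; rewrite /carlitz.
rewrite (big_ord_widen n (fun i => (a`_i)%:P *: e i) le_an) big_mkcond /=.
apply: eq_bigr => i _; case: ltnP => // le_ai.
by rewrite (nth_default _ le_ai) polyC0 scale0r.
Qed.

Lemma carlitzD a b : carlitz (a + b) = carlitz a + carlitz b.
Proof.
pose n := maxn (size a) (size b).
rewrite (@carlitz_widen n) ?size_polyD // (@carlitz_widen n a) ?leq_maxl //.
rewrite (@carlitz_widen n b) ?leq_maxr // -big_split /=.
by apply: eq_bigr => i _; rewrite coefD polyCD scalerDl.
Qed.

Lemma carlitzZ (c : F) a : carlitz (c *: a) = c%:P *: carlitz a.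
Proof.
rewrite (@carlitz_widen (size a)) ?size_scale_leq // scaler_sumr.
by apply: eq_bigr => i _; rewrite coefZ polyCM scalerA.
Qed.

Lemma carlitz1 : carlitz (1 : {poly F}) = 'X.
Proof. by rewrite /carlitz size_poly1 big_ord1 coef1 scale1r. Qed.

Lemma carlitzC (c : F) : carlitz c%:P = c%:P *: 'X.
Proof. by rewrite -[X in carlitz X]alg_polyC carlitzZ carlitz1. Qed.

Lemma carlitz0 : carlitz (0 : {poly F}) = 0.
Proof. by rewrite /carlitz size_poly0 big_ord0. Qed.

Lemma carlitzMX a : carlitz (a * 'X) = \sum_(i < size a) (a`_i)%:P *: e i.+1.
Proof.
rewrite (@carlitz_widen (size a).+1); last first.
  by apply: leq_trans (size_polyMleq _ _) _; rewrite size_polyX addn2.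
rewrite big_ord_recl coefMX eqxx polyC0 scale0r add0r.
by apply: eq_bigr => i _; rewrite coefMX.
Qed.

Lemma carlitzMXr a : carlitz (a * 'X) = carlitz a \Po carlitzT F.
Proof.
have eSr i : e i.+1 = e i \Po carlitzT F.
  elim: i => [|i IHi]; first by rewrite /e /= comp_polyXr comp_polyX.
  by rewrite -[LHS]/(carlitzT F \Po e i.+1) {1}IHi comp_polyA.
rewrite carlitzMX /carlitz raddf_sum; apply: eq_bigr => i _.
by rewrite eSr /= comp_polyZ.
Qed.

Lemma carlitzMXl a : carlitz (a * 'X) = carlitzT F \Po carlitz a.
Proof.
have TC0 : carlitzT F \Po 0 = 0.
  by rewrite carlitzT_comp scaler0 add0r expr0n gtn_eqF // (ltnW (finNzRing_gt1 F)).
rewrite carlitzMX [RHS](big_morph (fun f => carlitzT F \Po f) carlitzT_compD TC0).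
by apply: eq_bigr => i _; rewrite carlitzT_compZ.
Qed.

Lemma carlitzM a b : carlitz (a * b) = carlitz a \Po carlitz b.
Proof.
elim/poly_ind: a b => [|a c IHa] b; first by rewrite mul0r carlitz0 comp_poly0.
rewrite mulrDl mul_polyC !carlitzD -mulrA (mulrC 'X) IHa (carlitzMXl b) comp_polyA.
by rewrite -carlitzMXr comp_polyD carlitzZ carlitzC comp_polyZ comp_polyX.
Qed.

Lemma carlitzX : carlitz ('X : {poly F}) = carlitzT F.
Proof. by rewrite -[X in carlitz X]mul1r carlitzMXr carlitz1 comp_polyX. Qed.

Lemma Fq_linear0 : Fq_linear (0 : {poly {poly F}}).
Proof. by move=> i; rewrite coef0 eqxx. Qed.

Lemma Fq_linearD f g : Fq_linear f -> Fq_linear g -> Fq_linear (f + g).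
Proof.
move=> lf lg i; rewrite coefD; have [->|/lf //] := eqVneq f`_i 0.
by rewrite add0r => /lg.
Qed.

Lemma Fq_linearZ a f : Fq_linear f -> Fq_linear (a *: f).
Proof.
move=> lf i; rewrite coefZ; have [->|/lf //] := eqVneq f`_i 0.
by rewrite mulr0 eqxx.
Qed.

Lemma Fq_linear_frob f : Fq_linear f -> Fq_linear (f ^+ #|F|).
Proof.
move=> lf; have q0 : (#|F| == 0)%N = false by rewrite gtn_eqF // (ltnW (finNzRing_gt1 F)).
rewrite -[f]coefK poly_def.
rewrite (big_morph _ carlitz_frobD (_ : 0 ^+ #|F| = 0)); last by rewrite expr0n q0.
apply: big_ind => [||i _]; [exact: Fq_linear0 | exact: Fq_linearD |].
rewrite exprZn; have [->|/lf[k ->]] := eqVneq f`_i 0.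
  by rewrite expr0n q0 scale0r; apply: Fq_linear0.
apply: Fq_linearZ => j; rewrite -exprM coefXn; have [->|] := eqVneq j; last by rewrite eqxx.
by exists k.+1; rewrite expnSr.
Qed.

Lemma carlitz_Fq_linear a : Fq_linear (carlitz a).
Proof.
apply: big_ind => [||i _]; [exact: Fq_linear0 | exact: Fq_linearD |].
apply: Fq_linearZ; elim: (i : nat) => [|n IHn] /=.
  move=> j; rewrite coefX; have [->|] := eqVneq j; last by rewrite eqxx.
  by exists 0%N.
rewrite carlitzT_comp; apply: Fq_linearD; first exact: Fq_linearZ.
exact: Fq_linear_frob.
Qed.

Lemma carlitzP : is_carlitz_module (@carlitz F).
Proof.
split; [exact: carlitz_Fq_linear | exact: carlitzD | exact: carlitzZ
  | exact: carlitz1 | exact: carlitzM | exact: carlitzX].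
Qed.

Lemma carlitz_unique (C : {poly F} -> {poly {poly F}}) :
  is_carlitz_module C -> C =1 @carlitz F.
Proof.
case=> _ CD CZ C1 CM CT; elim/poly_ind => [|a c IHa].
  by rewrite carlitz0 -[X in C X](scale0r 0) CZ polyC0 scale0r.
rewrite CD CM CT IHa carlitzD carlitzMXr carlitzC.
by rewrite -[X in C X]alg_polyC CZ C1.
Qed.

End CarlitzTheory.

(* Main.v *)
(* If Q is a monic prime of degree d, then C_Q(x) = x^(q^d) modulo Q: the
   reduction f of C_Q commutes with t x + x^q, where t is the class of T, so its
   lowest degree q^k satisfies t^(q^k) = t; here k > 0 since C_Q has linear
   coefficient Q.  As t generates A/Q, the q^d elements of A/Q are roots of
   x^(q^k) - x, so k >= d and f is its leading term x^(q^d).  In particular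
   Q divides C_(Q-1)(1).  If Q also divides C_P(1), the annihilator of 1 in A/Q
   under the Carlitz action contains P and Q - 1; it is a proper ideal, so the
   prime P divides Q - 1. *)

Require Import Defs.
From mathcomp Require Import all_boot all_order all_algebra.
From mathcomp Require Import qpoly falgebra fieldext finfield.
Import GRing.Theory VectorInternalTheory.
Local Open Scope ring_scope.

Lemma carlitz_coef0 (F : finFieldType) (a : {poly F}) : (carlitz a)`_0 = 0.
Proof.
apply/eqP; apply: contraT => /carlitz_Fq_linear[k /esym/eqP].
by rewrite expn_eq0 gtn_eqF // (ltnW (finNzRing_gt1 F)).
Qed.

(** By induction from [C_(aT) = T C_a + C_a^q]: as [C_a] has no constant term, [x^q] divides
    [C_a^q], which adds nothing in degree 1. *)
Lemma carlitz_coef1 (F : finFieldType) (a : {poly F}) : (carlitz a)`_1 = a.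
Proof.
elim/poly_ind: a => [|a c IHa]; first by rewrite carlitz0 coef0.
have q_gt1 := finNzRing_gt1 F.
have /factor_theorem[g Dg]: root (carlitz a) 0.
  by rewrite /root horner_coef0 carlitz_coef0.
rewrite carlitzD carlitzMXl carlitzC carlitzT_comp !(coefD, coefZ) IHa mulrC.
by rewrite {1}Dg subr0 exprMn coefMXn q_gt1 addr0 coefX mulr1.
Qed.

(** Composing with the monic [C_T] multiplies the degree by [q] and keeps the leading coefficient; a
    constant [c] adds only [c x], of lower degree. *)
Lemma size_lead_carlitz (F : finFieldType) (a : {poly F}) : a != 0 ->
  size (carlitz a) = (#|F| ^ (size a).-1).+1
  /\ lead_coef (carlitz a) = (lead_coef a)%:P.
Proof.
have q_gt1 := finNzRing_gt1 F.
have szT : size (carlitzT F) = #|F|.+1.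
  rewrite /carlitzT addrC size_polyDl size_polyXn //.
  by apply: leq_ltn_trans (size_scale_leq _ _) _; rewrite size_polyX ltnS.
have lcT : lead_coef (carlitzT F) = 1.
  rewrite /carlitzT lead_coefDr ?lead_coefXn // size_polyXn.
  by apply: leq_ltn_trans (size_scale_leq _ _) _; rewrite size_polyX ltnS.
elim/poly_ind: a => [|a c IHa]; first by rewrite eqxx.
have [-> | nz_a _] := eqVneq a 0.
  rewrite mul0r add0r polyC_eq0 => nz_c; rewrite carlitzC size_polyC nz_c.
  have nz_cP : c%:P != 0 :> {poly F} by rewrite polyC_eq0.
  by rewrite size_scale // size_polyX lead_coefZ lead_coefX mulr1 lead_coefC.
have [sza lca] := IHa nz_a; have sz_gt0 : (0 < size a)%N by rewrite size_poly_gt0.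
have sz1 : size (carlitz (a * 'X)) = (#|F| ^ size a).+1.
  rewrite carlitzMXr -[LHS]prednK.
    by rewrite size_comp_poly sza szT /= -expnSr prednK.
  rewrite size_poly_gt0 -lead_coef_eq0 lead_coef_comp ?szT //.
    by rewrite lcT expr1n mulr1 lca polyC_eq0 lead_coef_eq0.
  exact: ltnW.
have lt_sz : (size (carlitz c%:P) < size (carlitz (a * 'X)))%N.
  rewrite carlitzC (leq_ltn_trans (size_scale_leq _ _)) // sz1 size_polyX ltnS.
  by rewrite (leq_trans q_gt1) // -{1}[#|F|]expn1 leq_exp2l.
rewrite carlitzD size_polyDl // lead_coefDl // sz1 size_MXaddC (negPf nz_a) /=.
split=> //; rewrite lead_coefDl ?lead_coefMX; last first.
  by rewrite size_mulX // ltnS (leq_trans (size_polyC_leq1 _)).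
rewrite carlitzMXr lead_coef_comp ?szT; first by rewrite lcT expr1n mulr1.
exact: ltnW.
Qed.

(* If [f] commutes with [t X + X^q], comparing the coefficients of lowest
   degree [m] on both sides gives [t^m = t]. *)
Lemma comp_lowest_coef (L : fieldType) (q m : nat) (t : L) (g : {poly L}) :
    (1 < q)%N -> (0 < m)%N -> g`_0 != 0 -> let f := g * 'X^m in
    f \Po (t *: 'X + 'X^q) = t *: f + f ^+ q ->
  t ^+ m = t.
Proof.
move=> q_gt1 m_gt0 nz_g0 f; have q_gt0 := ltnW q_gt1.
have -> : t *: 'X + 'X^q = (t%:P + 'X^(q.-1)) * 'X.
  by rewrite mulrDl mul_polyC -exprSr prednK.
(* With [t X + X^q = s X], the left side is [(g \Po (s X)) s^m X^m], whose coefficient at [m] is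
   [g(0) t^m]. On the right, [f^q] starts in degree [m q > m], leaving [t g(0)]. *)
set s := _ + 'X^_; have s0 : s`_0 = t.
  by rewrite coefD coefC eqxx coefXn -subn1 eq_sym subn_eq0 leqNgt q_gt1 addr0.
rewrite /f comp_polyM comp_Xn_poly exprMn mulrA => /(congr1 (fun p : {poly L} => p`_m)).
rewrite coefD coefZ !coefMXn ltnn subnn exprMn -exprM coefMXn.
rewrite ltn_Pmulr // addr0 coef0M -!horner_coef0 horner_comp hornerMX mulr0.
rewrite horner_exp !horner_coef0 s0.
by rewrite [RHS]mulrC => /(mulfI nz_g0).
Qed.

(** The [q]-power map is additive and fixes the coefficients, so it only replaces [T] by [T^q]. *)
Lemma Fpoly_frob (F : finFieldType) (k : nat) (a : {poly F}) :
  a ^+ (#|F| ^ k) = a \Po 'X^(#|F| ^ k).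
Proof.
have frobD (u v : {poly F}) : (u + v) ^+ #|F| = u ^+ #|F| + v ^+ #|F|.
  by apply: (@polyC_inj {poly F}); rewrite !(polyCD, polyC_exp) carlitz_frobD.
have frob1 (u : {poly F}) : u ^+ #|F| = u \Po 'X^#|F|.
  elim/poly_ind: u => [|u c IHu].
    by rewrite comp_poly0 expr0n gtn_eqF // (ltnW (finNzRing_gt1 F)).
  rewrite frobD exprMn IHu -polyC_exp expf_card comp_polyD comp_polyM.
  by rewrite comp_polyX comp_polyC.
elim: k => [|k IHk]; first by rewrite expr1 comp_polyXr.
by rewrite expnSr exprM IHk frob1 -comp_polyA comp_Xn_poly -exprM mulnC.
Qed.

Lemma frob_fixed_generator (F : finFieldType) (L : fieldExtType F) (z : L) k :
    <<1; z>>%VS = fullv -> z ^+ (#|F| ^ k) = z -> (0 < k)%N ->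
  (\dim {:L} <= k)%N.
Proof.
move=> genL zk k_gt0; have q_gt1 := finNzRing_gt1 F.
have fixL (v : L) : v ^+ (#|F| ^ k) = v.
  have /Fadjoin_polyP[p /polyOver1P[a ->] ->]: v \in <<1; z>>%VS.
    by rewrite genL memvf.
  by rewrite -horner_exp -rmorphXn /= Fpoly_frob map_comp_poly map_polyXn
    horner_comp hornerXn zk.
pose N := (#|F| ^ k)%N.
have N_gt1 : (1 < N)%N by rewrite -(exp1n k) ltn_exp2r.
have szXN : size ('X^N - 'X : {poly L}) = N.+1.
  by rewrite size_polyDl ?size_polyXn // size_polyN size_polyX ltnS.
have nzXN : 'X^N - 'X != 0 :> {poly L} by rewrite -size_poly_gt0 szXN.
(* Coordinate vectors over [F] enumerate the [q^dim L] elements of [L], all of them roots of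
   [X^N - X]. *)
pose rL : seq L := [seq r2v v | v <- enum {: 'rV[F]_(dim L)}].
have uniq_rL : uniq rL by rewrite (map_inj_uniq (can_inj r2vK)) enum_uniq.
have := max_poly_roots nzXN _ uniq_rL.
rewrite szXN size_map -cardE card_mx mul1n dimvf ltnS leq_exp2l //; apply.
by apply/allP => v _; rewrite /root !hornerE fixL subrr.
Qed.

Lemma carlitz_irreducible_mod (F : finFieldType) (Q : {poly F})
    (L : fieldExtType F) (z : L) :
    Q \is monic -> \dim {:L} = (size Q).-1 ->
    root (map_poly (in_alg L) Q) z -> <<1; z>>%VS = fullv ->
  map_poly (horner_alg z) (carlitz Q) = 'X^(#|F| ^ (size Q).-1).
Proof.
move=> monQ dimL Qz0 genL; have q_gt1 := finNzRing_gt1 F.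
have [szC lcC] := size_lead_carlitz _ _ (monic_neq0 monQ).
rewrite (monicP monQ) in lcC; set f := map_poly _ _.
have lc1 : horner_alg z (lead_coef (carlitz Q)) = 1 by rewrite lcC rmorph1.
have szf : size f = (#|F| ^ (size Q).-1).+1.
  by rewrite size_map_poly_id0 ?lc1 ?oner_neq0.
have monf : f \is monic.
  by rewrite monicE lead_coef_map_id0 ?lc1 ?oner_neq0 ?raddf0.
(* The multiplicity [m] of the root 0 is the lowest degree occurring in [f]. *)
have [m [g]] := multiplicity_XsubC f 0.
rewrite (monic_neq0 monf) /root horner_coef0 subr0 /= => nz_g0 Df.
have nz_fm : (carlitz Q)`_m != 0.
  apply: contraNneq nz_g0 => Cm0; have: f`_m = 0 by rewrite coef_map /= Cm0 rmorph0.
  by rewrite Df coefMXn ltnn subnn => ->.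
have [k Dm] := carlitz_Fq_linear nz_fm.
have k_gt0 : (0 < k)%N.
  rewrite lt0n; apply: contraNneq nz_g0 => k0.
  have: f`_m = 0 by rewrite coef_map /= Dm k0 carlitz_coef1; exact/eqP.
  by rewrite Df coefMXn ltnn subnn => ->.
have zm : z ^+ m = z.
  apply: (comp_lowest_coef _ #|F| m z g) => //.
    by rewrite Dm expn_gt0 (ltnW q_gt1).
  have mapT : map_poly (horner_alg z) (carlitzT F) = z *: 'X + 'X^#|F|.
    by rewrite rmorphD /= map_polyZ /= horner_algX map_polyX map_polyXn.
  (* Both composites of [C_Q] and [C_T] equal [C_(QT)]. *)
  rewrite -Df -mapT -map_comp_poly -carlitzMXr carlitzMXl carlitzT_comp.
  by rewrite rmorphD rmorphXn /= map_polyZ /= horner_algX.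
have le_dk : ((size Q).-1 <= k)%N.
  by rewrite -dimL (frob_fixed_generator _ _ _ _ genL) // -Dm.
have mong : g \is monic by rewrite -(monicMr _ (monicXn _ m)) -Df.
(* The degree of [g] is [q^d - m] with [d] the degree of [Q], and [m = q^k >= q^d]. *)
have /size_poly1P[c nz_c Dg] : size g == 1%N.
  have le_m : (#|F| ^ (size Q).-1 <= m)%N by rewrite Dm leq_exp2l.
  move: szf; rewrite Df size_Mmonic ?monic_neq0 ?monicXn // size_polyXn addnS /=.
  move=> szg; rewrite eqn_leq size_poly_gt0 (monic_neq0 mong) andbT.
  by rewrite -(leq_add2r m) szg add1n ltnS.
have g1 : g = 1.
  by move: mong; rewrite Dg monicE lead_coefC => /eqP ->.
by move: szf; rewrite Df g1 mul1r size_polyXn => -[->].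
Qed.

Theorem theorem4p4 (F : finFieldType) (P : {poly F}) (alpha : F)
    (P_monic : P \is monic) (P_prime : irreducible_poly P)
    (alpha_neq0 : alpha != 0) :
  let M_P : {poly F} := alpha *: (carlitz P).[1] in
  forall Q : {poly F}, Q \is monic -> irreducible_poly Q ->
    Q %| M_P -> P %| Q - 1.
Proof.
move=> M_P Q monQ irrQ; rewrite dvdpZr // => /dvdpP[b Db].
(* [L] is a model of [A/Q] with [z] the class of [T], and [phi] is reduction modulo [Q]. *)
have [L dimL [z Qz0 genL]] := irredp_FAdjoin irrQ.
pose phi : {rmorphism {poly F} -> L} := horner_alg z.
have phiQ : phi Q = 0 by apply/eqP.
have CP0 : phi (carlitz P).[1] = 0 by rewrite Db rmorphM phiQ mulr0.
have CQ0 : phi (carlitz (Q - 1)).[1] = 0.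
  rewrite -scaleN1r carlitzD carlitzZ carlitz1 hornerD rmorphD.
  rewrite -horner_map rmorph1 /= (carlitz_irreducible_mod _ _ _ _ monQ dimL Qz0 genL).
  by rewrite hornerXn expr1n hornerZ hornerX mulr1 polyCN rmorphN !rmorph1 subrr.
(* The kernel of [phi] is stable under every [C_a], which has no constant term. *)
have Cmul0 a v : phi v = 0 -> phi (carlitz a).[v] = 0.
  by move=> v0; rewrite -horner_map v0 horner_coef0 coef_map /= carlitz_coef0 rmorph0.
apply: contraT; rewrite -irreducible_poly_coprime //.
(* If [u P + v (Q - 1) = 1], then [C_1(1) = 1] would vanish modulo [Q]. *)
case/Bezout_eq1_coprimepP=> -[u v] /= uv1.
have: phi (carlitz 1).[1] = 0.
  rewrite -[X in carlitz X]uv1 carlitzD !carlitzM hornerD !horner_comp rmorphD.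
  by rewrite (Cmul0 u) ?(Cmul0 v) ?addr0.
by rewrite carlitz1 hornerX rmorph1 => /eqP; rewrite oner_eq0.
Qed.
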